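(* Let $f:\mathbb{R}^d\to\mathbb{R}$ be $\mathcal{C}^2$ and strongly convex, $\varepsilon>0$, $\gamma\ge0$, $A>0$ constants, and let $B(\mathbf{x})\in\mathbb{R}^{d\times d}$ be symmetric positive definite with $C(\mathbf{x})=B(\mathbf{x})\nabla^2 f(\mathbf{x})$. Suppose there are constants $L\ge\mu>0$ with $\mu\le1$ such that $$\mu\mathbb{I}\preceq C_0(\mathbf{x})\preceq L\mathbb{I}\quad\text{for all }\mathbf{x},\qquad C_0(\mathbf{x})=\nabla^2 f(\mathbf{x})B(\mathbf{x})\nabla^2 f(\mathbf{x}).$$ Let $(\mathbf{x}(t),\mathbf{p}(t))$ solve the ODE system $$\dot{\mathbf{p}}=A\nabla f(\mathbf{x})-\varepsilon A\mathbf{p},\qquad \dot{\mathbf{x}}=-C(\mathbf{x})\big(\mathbf{p}+\gamma(A\nabla f(\mathbf{x})-\varepsilon A\mathbf{p})\big)$$ with initial condition $(\mathbf{x}(0),\mathbf{p}(0))\in\mathbb{R}^{2d}$, and define $\mathcal{I}(\mathbf{x},\mathbf{p})=\frac12(\|\mathbf{p}\|^2+\|\nabla f(\mathbf{x})\|^2)$. Then $$\mathcal{I}(\mathbf{x}(t),\mathbf{p}(t))\le\mathcal{I}(\mathbf{x}(0),\mathbf{p}(0))\exp(-2\lambda t),$$ where $$\lambda=\min\Big\{\mu\gamma A-\tfrac12|A-\mu(1-\varepsilon\gamma A)|,\ L\gamma A-\tfrac12|A-L(1-\varepsilon\gamma A)|,\ \varepsilon A-\tfrac12|A-\mu(1-\varepsilon\gamma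 A)|,\ \varepsilon A-\tfrac12|A-L(1-\varepsilon\gamma A)|\Big\}.$$ In particular, when $\gamma=\frac1\mu$, $\varepsilon=1$, $A=\frac{\mu+L}{2+(\mu+L)\varepsilon\gamma}$, then $\lambda=\frac\mu2$.
   Context: $\mathbb{I}$ is the $d\times d$ identity matrix, $\|\cdot\|$ the Euclidean norm, and $\preceq$ the Loewner order on symmetric matrices. *)

(* Defs.v *)
From HB Require Import structures.
From mathcomp Require Import all_boot all_order all_algebra.
From mathcomp Require Import all_classical all_reals all_analysis.

Set Implicit Arguments.
Unset Strict Implicit.
Unset Printing Implicit Defensive.

Import Order.TTheory GRing.Theory Num.Theory.
Import numFieldNormedType.Exports.

Local Open Scope classical_set_scope.
Local Open Scope ring_scope.

Section Defs.
Context {R : realType} {d : nat}.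
Implicit Types (f : 'cV[R]_d -> R) (M N : 'M[R]_d) (u v : 'cV[R]_d).

(* The library norm `|v| on matrices is the sup norm, not this one; both
   induce the same topology and notion of differentiability. *)
Definition norm2 v : R := Num.sqrt (\sum_i v i 0 ^+ 2).

Definition quad M v : R := (v^T *m M *m v) 0 0.

Definition posdef M : Prop := M^T = M /\ forall v, v != 0 -> 0 < quad M v.

Definition possemidef M : Prop := M^T = M /\ forall v, 0 <= quad M v.

Definition loewner_le M N : Prop := possemidef (N - M).

Definition gradient f (x : 'cV[R]_d) : 'cV[R]_d :=
  \col_i 'D_(delta_mx i 0) f x.

Definition hessian f (x : 'cV[R]_d) : 'M[R]_d :=
  \matrix_(i, j) 'D_(delta_mx j 0) ('D_(delta_mx i 0) f) x.

(* f is Frechet differentiable and its gradient is of class C^1; the Jacobian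
   matrix of the gradient is the Hessian. *)
Definition classC2 f : Prop :=
  [/\ forall x, differentiable f x,
      forall x, differentiable (gradient f) x
    & continuous (hessian f)].

Definition strongly_convex f : Prop :=
  exists2 m : R, 0 < m &
    forall (x y : 'cV[R]_d) (t : R), 0 <= t -> t <= 1 ->
      f (t *: x + (1 - t) *: y) <=
        t * f x + (1 - t) * f y - m / 2 * t * (1 - t) * norm2 (x - y) ^+ 2.

Definition Cmx f (B : 'cV[R]_d -> 'M[R]_d) (x : 'cV[R]_d) : 'M[R]_d :=
  B x *m hessian f x.

Definition C0mx f (B : 'cV[R]_d -> 'M[R]_d) (x : 'cV[R]_d) : 'M[R]_d :=
  hessian f x *m B x *m hessian f x.

Definition p_rhs f (eps A : R) (x p : 'cV[R]_d) : 'cV[R]_d :=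
  A *: gradient f x - (eps * A) *: p.

Definition x_rhs f (B : 'cV[R]_d -> 'M[R]_d) (eps gamma A : R)
    (x p : 'cV[R]_d) : 'cV[R]_d :=
  - (Cmx f B x *m (p + gamma *: p_rhs f eps A x p)).

(* Solution on [0, +oo[: the trajectories are only constrained for t >= 0,
   so at the endpoint 0 we ask for one-sided continuity only. *)
Definition ode_solution f (B : 'cV[R]_d -> 'M[R]_d) (eps gamma A : R)
    (x p : R -> 'cV[R]_d) : Prop :=
  [/\ {within `[0, +oo[, continuous x},
      {within `[0, +oo[, continuous p},
      forall t : R, 0 < t ->
        is_derive t 1 p (p_rhs f eps A (x t) (p t))
    & forall t : R, 0 < t ->
        is_derive t 1 x (x_rhs f B eps gamma A (x t) (p t))].

Definition lyapunov f (x p : 'cV[R]_d) : R :=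
  (norm2 p ^+ 2 + norm2 (gradient f x) ^+ 2) / 2.

End Defs.

Definition rate {R : realType} (mu L eps gamma A : R) : R :=
  let dev (c : R) := `|A - c * (1 - eps * gamma * A)| / 2 in
  Num.min (Num.min (mu * gamma * A - dev mu) (L * gamma * A - dev L))
          (Num.min (eps * A - dev mu) (eps * A - dev L)).

(* Main.v *)
Require Import Defs.
From mathcomp Require Import all_boot all_order all_algebra.
From mathcomp Require Import all_classical all_reals all_analysis.
From mathcomp Require Import ring lra.

(** Write [g] for the gradient of [f] along the trajectory. By the chain rule
    [g' = hessian f x *m x'], so the factor [C = B H] in the equation of [x']
    becomes the symmetric matrix [C0 = H B H], and the energy
    [(|p|^2 + |g|^2) / 2] has derivative
<<
    - eps A |p|^2 + A <g, p> - (1 - eps gamma A) <g, C0 p> - gamma A <g, C0 g>.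
>>
    It suffices to bound this by [- lambda (|p|^2 + |g|^2)]: multiplying the
    energy by [exp (2 lambda t)] then gives a nonincreasing function
    ([gronwall_decay]).

    On an eigenspace of [C0] with eigenvalue [c] the derivative is a quadratic
    form in two variables with cross coefficient [A - c (1 - eps gamma A)], and
    the inequality of arithmetic and geometric means bounds it by the two terms
    of [lambda] that belong to [c]; these terms are concave in [c], so their
    minimum over [mu, L] is attained at an endpoint. The same argument runs
    directly on matrices: the derivative is affine in [C0], and
<<
    (L - mu) C0 = mu (L - C0) + L (C0 - mu),
    (L - mu) I  =    (L - C0) +   (C0 - mu)
>>
    exhibit [C0] and the identity as combinations of the endpoint values [mu]
    and [L] with the same positive semidefinite weights [L - C0] and [C0 - mu].
    Applying the endpoint estimate in the bilinear form of each weight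
    ([possemidef_dissipation]) and adding proves [L - mu] times the bound
    ([loewner_dissipation]); if [mu = L], then [C0 = mu I] and the endpoint
    estimate is the bound.

    For the special parameters, with [A = mu (mu + L) / (3 mu + L)], the two
    cross coefficients are opposite, [+- mu (L - mu) / (3 mu + L)], and three of
    the four terms of [lambda] are at most the remaining one and equal to
    [mu / 2] ([rate_opt]). *)

Set Implicit Arguments.
Unset Strict Implicit.
Unset Printing Implicit Defensive.

Import Order.TTheory GRing.Theory Num.Theory.
Import numFieldNormedType.Exports.
Local Open Scope ring_scope.

(** * Bilinear forms and the Loewner order *)

Definition bil {R : realType} {d : nat} (M : 'M[R]_d) (u v : 'cV[R]_d) : R :=
  (u^T *m M *m v) 0 0.

Section Bilinear.
Context {R : realType} {d : nat}.
Implicit Types (M N : 'M[R]_d) (u v w : 'cV[R]_d).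

Lemma bilDl M u v w : bil M (u + v) w = bil M u w + bil M v w.
Proof. by rewrite /bil linearD /= !mulmxDl mxE. Qed.

Lemma bilDr M u v w : bil M u (v + w) = bil M u v + bil M u w.
Proof. by rewrite /bil mulmxDr mxE. Qed.

Lemma bilNr M u v : bil M u (- v) = - bil M u v.
Proof. by rewrite /bil mulmxN mxE. Qed.

Lemma bilNl M u v : bil M (- u) v = - bil M u v.
Proof. by rewrite /bil linearN /= !mulNmx mxE. Qed.

Lemma bilZr M a u v : bil M u (a *: v) = a * bil M u v.
Proof. by rewrite /bil -scalemxAr mxE. Qed.

Lemma bilBm M N u v : bil (M - N) u v = bil M u v - bil N u v.
Proof. by rewrite /bil mulmxBr mulmxBl !mxE. Qed.

Lemma bil_scalar a u v : bil a%:M u v = a * bil 1%:M u v.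
Proof.
by rewrite /bil mul_mx_scalar mulmx1 -scalemxAl mxE.
Qed.

Lemma bil1_mul M u v : bil 1%:M u (M *m v) = bil M u v.
Proof. by rewrite /bil mulmx1 mulmxA. Qed.

Lemma bilC M u v : M^T = M -> bil M u v = bil M v u.
Proof.
move=> MT.
by rewrite /bil -[u^T *m M *m v]trmxK mxE !trmx_mul trmxK MT mulmxA.
Qed.

Lemma bil1E u v : bil 1%:M u v = \sum_i u i 0 * v i 0.
Proof.
by rewrite /bil mulmx1 mxE; apply: eq_bigr => i _; rewrite mxE.
Qed.

Lemma norm2_sqE u : norm2 u ^+ 2 = bil 1%:M u u.
Proof.
rewrite /norm2 sqr_sqrtr; last by apply: sumr_ge0 => i _; exact: sqr_ge0.
by rewrite bil1E; apply: eq_bigr => i _; rewrite expr2.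
Qed.

Lemma possemidef1 : possemidef (1%:M : 'M[R]_d).
Proof.
split=> [|v]; first exact: trmx1.
by rewrite -[quad _ _]/(bil _ _ _) -norm2_sqE sqr_ge0.
Qed.

(** Both [u + v] and [u - v] have nonnegative energy; expanding the two
    inequalities bounds the cross term from either side. *)
Lemma possemidef_cross M u v : possemidef M ->
  `|bil M u v| <= (quad M u + quad M v) / 2.
Proof.
move=> [MT M0]; have := M0 (u + v); have := M0 (u - v).
rewrite /quad -!/(bil _ _ _) !(bilDl, bilDr, bilNl, bilNr) [bil M v u]bilC//.
by rewrite ler_norml => ? ?; apply/andP; split; lra.
Qed.

(** The endpoint estimate: in the semi-inner product of [M], half of the cross
    term is charged to each of the two square terms. *)
Lemma possemidef_dissipation M (a b k lambda : R) u v : possemidef M ->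
  lambda <= a - `|k| / 2 -> lambda <= b - `|k| / 2 ->
  - a * quad M u + k * bil M v u - b * quad M v
    <= - lambda * (quad M u + quad M v).
Proof.
move=> M0 la lb; have := possemidef_cross v u M0.
have := M0.2 u; have := M0.2 v.
set x := quad M u; set y := quad M v => y0 x0 cr.
have : k * bil M v u <= `|k| * ((y + x) / 2).
  by apply: (le_trans (ler_norm _)); rewrite normrM ler_wpM2l.
have : (lambda + `|k| / 2) * x <= a * x by apply: ler_wpM2r => //; lra.
have : (lambda + `|k| / 2) * y <= b * y by apply: ler_wpM2r => //; lra.
lra.
Qed.

End Bilinear.

(** * Dissipation of the energy *)

Lemma rate_le {R : realType} (mu L eps gamma A : R) (c : R) :
  c = mu \/ c = L ->
  rate mu L eps gamma A
    <= c * gamma * A - `|A - c * (1 - eps * gamma * A)| / 2 /\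
  rate mu L eps gamma A
    <= eps * A - `|A - c * (1 - eps * gamma * A)| / 2.
Proof.
by rewrite /rate => -[->|->]; split; rewrite !ge_min lexx ?orbT.
Qed.

(** [u] is the momentum and [v] the gradient; the left-hand side is the
    derivative of the energy. The weight [L - C] goes with the endpoint [mu]
    and the weight [C - mu] with the endpoint [L]. *)
Lemma loewner_dissipation {R : realType} {d : nat} (C : 'M[R]_d)
    (eps gamma A mu L : R) (u v : 'cV[R]_d) :
  mu <= L -> loewner_le mu%:M C -> loewner_le C L%:M ->
  - (eps * A) * bil 1%:M u u + A * bil 1%:M v u
    - (1 - eps * gamma * A) * bil C v u - gamma * A * bil C v v
  <= - rate mu L eps gamma A * (bil 1%:M u u + bil 1%:M v v).
Proof.
move=> muL CgeM CleM.
have [m1 m2] := @rate_le R mu L eps gamma A mu (or_introl erefl).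
have [l1 l2] := @rate_le R mu L eps gamma A L (or_intror erefl).
set lambda := rate _ _ _ _ _ in m1 m2 l1 l2 *.
have P := possemidef_dissipation u v CleM m2 m1.
have Q := possemidef_dissipation u v CgeM l2 l1.
have crP := possemidef_cross v u CleM.
have crQ := possemidef_cross v u CgeM.
have := CgeM.2 u; have := CgeM.2 v; have := CleM.2 u; have := CleM.2 v.
have I1 := possemidef_dissipation u v possemidef1 m2 m1.
move: P Q I1 crP crQ; rewrite /quad -!/(bil _ _ _).
rewrite !bilBm !(bil_scalar mu) !(bil_scalar L).
set uu := bil 1%:M u u; set vv := bil 1%:M v v; set vu := bil 1%:M v u.
set cuu := bil C u u; set cvv := bil C v v; set cvu := bil C v u.
move=> P Q I1 crP crQ h1 h2 h3 h4.
have [muLE|muL'] := eqVneq mu L.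
  (* Both weights vanish here, so [C = mu I] as a bilinear form and the
     identity matrix takes their place. *)
  subst L.
  have E1 : cuu = mu * uu by lra.
  have E2 : cvv = mu * vv by lra.
  have E3 : cvu = mu * vu.
    apply/eqP; rewrite -subr_eq0 -normr_le0; apply: (le_trans crQ); lra.
  rewrite E2 E3; apply: le_trans I1; lra.
have Lmu : 0 < L - mu by rewrite subr_gt0 lt_neqAle muL'.
rewrite -(ler_pM2l Lmu).
have -> : (L - mu) * (- lambda * (uu + vv)) =
  - lambda * (L * uu - cuu + (L * vv - cvv))
  + - lambda * (cuu - mu * uu + (cvv - mu * vv)) by ring.
by apply: le_trans (lerD P Q); lra.
Qed.

(** * Differentiation along trajectories *)

Section Calculus.
Local Open Scope classical_set_scope.
Local Open Scope ring_scope.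
Context {R : realType}.

(** The differential inequality says that [h t * expR (c * t)] has nonpositive
    derivative for [0 < t]; one-sided continuity extends the comparison to the
    initial time. *)
Lemma gronwall_decay (h dh : R -> R) (c : R) :
  {within `[0, +oo[%classic, continuous h} ->
  (forall t : R, 0 < t -> is_derive t 1 h (dh t)) ->
  (forall t : R, 0 < t -> dh t <= - c * h t) ->
  forall t : R, 0 <= t -> h t <= h 0 * expR (- c * t).
Proof.
move=> hc hd hle t t0.
pose e := fun s : R => expR (c * s).
pose k := h \* e.
have ed (s : R) : is_derive s 1 e (c * e s).
  have -> : c * e s = e s * (c *: 1) by rewrite /GRing.scale /= mulr1 mulrC.
  exact: (is_derive1_comp (is_derive_expR (c * s))
           (is_deriveZ c (is_derive_id s 1))).
have kd (s : R) : 0 < s -> is_derive s 1 k (h s *: (c * e s) + e s *: dh s).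
  by move=> s0; have := hd s s0; have := ed s => ? ?; apply: is_deriveM.
have kle : k t <= k 0.
  apply: (@ler0_derive1_nincry _ k 0) => //.
  - by move=> s; rewrite in_itv /= andbT => s0; have [] := kd s s0.
  - move=> s; rewrite in_itv /= andbT => s0.
    rewrite derive1E (@derive_val _ _ _ _ _ _ _ (kd s s0)) /GRing.scale /=.
    have -> : h s * (c * e s) + e s * dh s = e s * (dh s - - c * h s) by ring.
    by rewrite mulr_ge0_le0 ?expR_ge0 // subr_le0 hle.
  - move=> s; apply: continuousM; first exact: hc.
    apply: continuous_subspaceT => y.
    apply: differentiable_continuous; apply/derivable1_diffP.
    by have [] := ed y.
move: kle; rewrite /k /= /e mulr0 expR0 mulr1 => kle.
by rewrite mulNr expRN ler_pdivlMr ?expR_gt0.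
Qed.

Lemma is_derive_coord m n (u : R -> 'M[R]_(m, n)) (t : R) (du : 'M[R]_(m, n))
    i j :
  is_derive t 1 u du -> is_derive t 1 (fun s => u s i j) (du i j).
Proof.
move=> [ud uE]; split; first by move/derivable_mxP : ud; apply.
by rewrite -uE (derive_mx ud) mxE.
Qed.

Context {d : nat}.

Lemma is_derive_norm2_sq (u : R -> 'cV[R]_d) (t : R) (du : 'cV[R]_d) :
  is_derive t 1 u du ->
  is_derive t 1 (fun s => norm2 (u s) ^+ 2) (2 * bil 1%:M (u t) du).
Proof.
move=> ud.
have -> : (fun s => norm2 (u s) ^+ 2) = \sum_(i < d) (fun s => u s i 0) ^+ 2.
  apply/funext => s; rewrite norm2_sqE bil1E fct_sumE.
  by apply: eq_bigr => i _; rewrite -expr2.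
rewrite bil1E mulr_sumr.
have -> : \sum_(i < d) 2 * (u t i 0 * du i 0) =
    \sum_(i < d) (2%:R * u t i 0 ^+ 1) *: du i 0.
  by apply: eq_bigr => i _; rewrite mulrA.
apply: is_derive_sum => i.
by apply: is_deriveX; apply: is_derive_coord.
Qed.

Lemma continuous_norm2_sq : continuous (fun v : 'cV[R]_d => norm2 v ^+ 2).
Proof.
have -> : (fun v : 'cV[R]_d => norm2 v ^+ 2) =
    (fun v => \sum_(i < d) v i 0 * v i 0).
  by apply/funext => v; rewrite norm2_sqE bil1E.
apply: continuous_big => [|i _ v]; first exact: add_continuous.
by apply: continuousM; apply: coord_continuous.
Qed.

(** Row [i] of the Hessian is the derivative of the [i]-th partial derivative,
    so the Hessian acts on column vectors as the Jacobian of the gradient. *)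
Lemma diff_gradient (f : 'cV[R]_d -> R) (x v : 'cV[R]_d) :
  differentiable (gradient f) x -> 'd (gradient f) x v = hessian f x *m v.
Proof.
move=> gd.
have {1}-> : v = \sum_(j < d) v j 0 *: delta_mx j 0.
  apply/colP => i; rewrite summxE (bigD1 i) //= !mxE !eqxx mulr1 big1 ?addr0//.
  by move=> j ji; rewrite !mxE eq_sym (negbTE ji) mulr0.
rewrite linear_sum; apply/colP => i; rewrite summxE mxE.
apply: eq_bigr => j _; rewrite linearZ mxE /= mulrC -deriveE // !mxE.
congr (_ * _); rewrite derive_mx; last exact: diff_derivable.
by rewrite mxE; congr ('D_ _ _ _); apply/funext => y; rewrite mxE.
Qed.

Lemma is_derive_gradient (f : 'cV[R]_d -> R) (x : R -> 'cV[R]_d) (t : R)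
    (dx : 'cV[R]_d) :
  differentiable (gradient f) (x t) -> is_derive t 1 x dx ->
  is_derive t 1 (gradient f \o x) (hessian f (x t) *m dx).
Proof.
move=> gd [xd xE]; have xdiff := (derivable1_diffP _ _).1 xd.
have gxd := differentiable_comp xdiff gd.
split; first exact: diff_derivable.
by rewrite deriveE // diff_comp //= -(deriveE (1 : R) xdiff) xE diff_gradient.
Qed.

End Calculus.

(** * The optimal parameters *)

(** This choice of [A] makes the two cross coefficients opposite, so all four
    terms of the rate subtract the same deviation from [A], [A], [A] and
    [L * mu^-1 * A]; the last of these is the largest. *)
Lemma rate_opt {R : realType} (mu L : R) : 0 < mu -> mu <= L ->
  let A := (mu + L) / (2 + (mu + L) * 1 * mu^-1) in
  rate mu L 1 mu^-1 A = mu / 2.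
Proof.
move=> mu0 muL A.
have D0 : 0 < 3 * mu + L by lra.
have AE : A = mu * (mu + L) / (3 * mu + L).
  by rewrite /A; field; rewrite !gt_eqF //; lra.
have muA : mu^-1 * A = (mu + L) / (3 * mu + L).
  by rewrite AE; field; rewrite !gt_eqF.
have dev : A - mu * (1 - 1 * mu^-1 * A) = mu * (L - mu) / (3 * mu + L).
  by rewrite mul1r muA AE; field; rewrite !gt_eqF.
have devL : A - L * (1 - 1 * mu^-1 * A) = - (mu * (L - mu) / (3 * mu + L)).
  by rewrite mul1r muA AE; field; rewrite !gt_eqF.
have dev0 : 0 <= mu * (L - mu) / (3 * mu + L).
  by rewrite divr_ge0 ?mulr_ge0 ?subr_ge0 // ltW.
have AdevE : A - mu * (L - mu) / (3 * mu + L) / 2 = mu / 2.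
  by rewrite AE; field; rewrite !gt_eqF.
rewrite /rate dev devL normrN (ger0_norm dev0) mul1r mulfV ?gt_eqF //.
rewrite mul1r AdevE.
have h : mu / 2 <= L * mu^-1 * A - mu * (L - mu) / (3 * mu + L) / 2.
  rewrite -AdevE lerD2r // -[leLHS]mul1r ler_wpM2r //.
    by rewrite AE divr_ge0 // ?mulr_ge0 // ltW //; lra.
  by rewrite ler_pdivlMr // mul1r.
by rewrite (min_l h) !minxx.
Qed.

(** * Energy decay *)

Section Trajectory.
Context {R : realType} {d : nat}.
Local Open Scope classical_set_scope.
Local Open Scope ring_scope.
Context {f : 'cV[R]_d -> R} {B : 'cV[R]_d -> 'M[R]_d}.
Context {eps gamma A : R} {x p : R -> 'cV[R]_d}.
Context (f_C2 : classC2 f) (sol : ode_solution f B eps gamma A x p).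

Lemma lyapunov_within_continuous :
  {within `[0, +oo[, continuous (fun t => lyapunov f (x t) (p t))}.
Proof.
have [xc pc _ _] := sol; have [_ gd _] := f_C2.
have -> : (fun t => lyapunov f (x t) (p t)) =
    ((fun t => norm2 (p t) ^+ 2) \+ (fun t => norm2 (gradient f (x t)) ^+ 2))
      \* cst 2^-1 by [].
move=> t; apply: continuousM; last exact: cvg_cst.
apply: continuousD.
  exact: (continuous_comp (pc t) (@continuous_norm2_sq _ _ (p t))).
have gc : {for x t, continuous (gradient f)}.
  exact: differentiable_continuous.
exact: (continuous_comp (continuous_comp (xc t) gc)
  (@continuous_norm2_sq _ _ (gradient f (x t)))).
Qed.

Lemma is_derive_lyapunov (t : R) : 0 < t ->
  is_derive t 1 (fun s => lyapunov f (x s) (p s))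
    (- (eps * A) * bil 1%:M (p t) (p t)
     + A * bil 1%:M (gradient f (x t)) (p t)
     - (1 - eps * gamma * A) * bil (C0mx f B (x t)) (gradient f (x t)) (p t)
     - gamma * A * bil (C0mx f B (x t)) (gradient f (x t)) (gradient f (x t))).
Proof.
move=> t0; have [_ _ pd xd] := sol; have [_ gd _] := f_C2.
have pN := is_derive_norm2_sq (pd t t0).
have gN := is_derive_norm2_sq (is_derive_gradient (gd _) (xd t t0)).
have hd := is_deriveZ 2^-1 (is_deriveD pN gN).
have -> : (fun s => lyapunov f (x s) (p s)) =
    2^-1 \*: ((fun s => norm2 (p s) ^+ 2)
              + (fun s => norm2 ((gradient f \o x) s) ^+ 2)).
  by apply/funext => s; rewrite /lyapunov mulrC.
apply: is_derive_eq hd _.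
rewrite /x_rhs /Cmx /= mulmxN bilNr !mulmxA -/(C0mx f B (x t)).
rewrite bil1_mul /p_rhs !(bilDr, bilNr, bilZr).
rewrite [bil 1%:M (p t) (gradient _ _)]bilC ?trmx1 //.
by rewrite /GRing.scale /=; field.
Qed.

End Trajectory.

Theorem theorem3p3 (R : realType) (d : nat)
    (f : 'cV[R]_d -> R) (B : 'cV[R]_d -> 'M[R]_d)
    (eps gamma A mu L : R) (x p : R -> 'cV[R]_d)
    (f_C2 : classC2 f) (f_sconv : strongly_convex f)
    (eps_gt0 : 0 < eps) (gamma_ge0 : 0 <= gamma) (A_gt0 : 0 < A)
    (B_posdef : forall y : 'cV[R]_d, posdef (B y))
    (mu_gt0 : 0 < mu) (mu_le_L : mu <= L) (mu_le1 : mu <= 1)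
    (C0_ge : forall y : 'cV[R]_d, loewner_le mu%:M (C0mx f B y))
    (C0_le : forall y : 'cV[R]_d, loewner_le (C0mx f B y) L%:M)
    (sol : ode_solution f B eps gamma A x p) :
  (forall t : R, 0 <= t ->
     lyapunov f (x t) (p t) <=
       lyapunov f (x 0) (p 0) * expR (- 2 * rate mu L eps gamma A * t))
  /\
  (gamma = mu^-1 -> eps = 1 ->
   A = (mu + L) / (2 + (mu + L) * eps * gamma) ->
   rate mu L eps gamma A = mu / 2).
Proof.
split; last by move=> -> -> ->; exact: rate_opt.
rewrite mulNr; apply: (gronwall_decay (lyapunov_within_continuous f_C2 sol)
  (is_derive_lyapunov f_C2 sol)) => t t0.
apply: le_trans (loewner_dissipation _ _ _ _ _ mu_le_L (C0_ge _) (C0_le _)) _.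
by rewrite /lyapunov !norm2_sqE; lra.
Qed.
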